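(* Let $f\in\mathcal{A}_1$ be strongly spirallike, i.e. there exist $\lambda\in(-\pi/2,\pi/2)$ and $\alpha\in(0,1)$ such that $|\operatorname{Arg}(zf'(z)/f(z))-\lambda|<\pi\alpha/2$ for all $z\in\mathbb{D}$. Then $\operatorname{Log}(f(z)/z)$ is bounded on $\mathbb{D}$. In particular, $f$ is bounded on $\mathbb{D}$. *)

(* Defs.v *)
From Stdlib Require Import Reals.
Open Scope R_scope.

Definition Cplx : Type := (R * R)%type.
Definition Cre (z : Cplx) : R := fst z.
Definition Cim (z : Cplx) : R := snd z.
Definition C0 : Cplx := (0, 0).
Definition C1 : Cplx := (1, 0).
Definition Cadd (z w : Cplx) : Cplx := (fst z + fst w, snd z + snd w).
Definition Copp (z : Cplx) : Cplx := (- fst z, - snd z).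
Definition Csub (z w : Cplx) : Cplx := Cadd z (Copp w).
Definition Cmul (z w : Cplx) : Cplx :=
  (fst z * fst w - snd z * snd w, fst z * snd w + snd z * fst w).
Definition Cinv (z : Cplx) : Cplx :=
  (fst z / (fst z ^ 2 + snd z ^ 2), - snd z / (fst z ^ 2 + snd z ^ 2)).
Definition Cdiv (z w : Cplx) : Cplx := Cmul z (Cinv w).
Definition Cnorm (z : Cplx) : R := sqrt (fst z ^ 2 + snd z ^ 2).
Definition Cexp (z : Cplx) : Cplx := (exp (fst z) * cos (snd z), exp (fst z) * sin (snd z)).

(* principal argument Arg z in (-PI, PI]  (Arg 0 := 0) *)
Definition Arg (z : Cplx) : R :=
  let x := fst z in let y := snd z in
  if Rlt_dec 0 x then atan (y / x)
  else if Rlt_dec x 0 then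
    (if Rle_dec 0 y then atan (y / x) + PI else atan (y / x) - PI)
  else if Rlt_dec 0 y then PI / 2
  else if Rlt_dec y 0 then - (PI / 2)
  else 0.

Definition in_disc (z : Cplx) : Prop := Cnorm z < 1.

Definition has_cderiv (f : Cplx -> Cplx) (z l : Cplx) : Prop :=
  forall eps : R, eps > 0 -> exists delta : R, delta > 0 /\
    forall h : Cplx, h <> C0 -> Cnorm h < delta -> in_disc (Cadd z h) ->
      Cnorm (Csub (Cdiv (Csub (f (Cadd z h)) (f z)) h) l) < eps.

Definition ccontinuous_on_disc (g : Cplx -> Cplx) : Prop :=
  forall z : Cplx, in_disc z -> forall eps : R, eps > 0 -> exists delta : R, delta > 0 /\
    forall w : Cplx, in_disc w -> Cnorm (Csub w z) < delta -> Cnorm (Csub (g w) (g z)) < eps.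

Definition in_A1 (f f' : Cplx -> Cplx) : Prop :=
  (forall z : Cplx, in_disc z -> has_cderiv f z (f' z)) /\ f C0 = C0 /\ f' C0 = C1.

Definition strongly_spirallike (f f' : Cplx -> Cplx) (lambda alpha : R) : Prop :=
  forall z : Cplx, in_disc z -> z <> C0 ->
    f z <> C0 /\
    Rabs (Arg (Cdiv (Cmul z (f' z)) (f z)) - lambda) < PI * alpha / 2.

(* Main.v *)
From Stdlib Require Import Reals Ranalysis5 Lra Lia ClassicalEpsilon.
From Coquelicot Require Import Rcomplements Hierarchy Continuity Derive Derive_2d AutoDerive.
Require Import Defs.
Open Scope R_scope.

(* In the coordinate [z = exp w], [Re w < 0], a continuous logarithm [F w] of [f (exp w)] has
   derivative [p = z f'(z) / f(z)], whose values lie in a convex sector [K] of opening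
   [PI alpha < PI]. By the mean value theorem every difference quotient
   [(F b - F a) / (b - a)] lies in the closure of [K]. Fix a line [Re w = s0] on which
   [F w - w] is bounded. For [b] to the right of that line, take two points [a], [c] on it, at
   height [Im b - L] and [Im b + L]: then [F b] lies both in [F a + (b - a) K] and in
   [F c + (b - c) K]. For [L] large the directions of [b - a] and [b - c] differ by more than
   the opening of [K], so these two sectors meet in a bounded set, uniformly in [b]. *)

(** * Continuous arguments on the disc *)

Lemma cos_sin_atan_quot (P Q : R) :
  0 < P -> P * P + Q * Q = 1 -> cos (atan (Q / P)) = P /\ sin (atan (Q / P)) = Q.
Proof.
  intros HP H.
  assert (E : sqrt (1 + (Q / P)²) = / P).
  { replace (1 + (Q / P)²) with (Rsqr (/ P)).
    - apply sqrt_Rsqr. left; now apply Rinv_0_lt_compat.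
    - unfold Rsqr. field_simplify; try lra. f_equal. nra. }
  rewrite cos_atan, sin_atan, E. split; field; lra.
Qed.

(** For [x < 0] the [atan] formula is applied to the opposite point, and the shift by [PI] reverses
    both signs. At the origin the modulus is zero, so any angle serves. The closed range of angles
    is what makes the polar rectangle below compact. *)
Lemma polar_Arg (x y : R) :
  - PI <= Arg (x, y) <= PI /\
  x = sqrt (x ^ 2 + y ^ 2) * cos (Arg (x, y)) /\
  y = sqrt (x ^ 2 + y ^ 2) * sin (Arg (x, y)).
Proof.
  set (r := sqrt (x ^ 2 + y ^ 2)).
  assert (Hr0 : 0 <= r) by apply sqrt_pos.
  assert (Hr : r * r = x ^ 2 + y ^ 2) by (apply sqrt_sqrt; nra).
  pose proof (atan_bound (y / x)) as Hb. pose proof PI_RGT_0 as Hpi.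
  assert (U : x <> 0 -> 0 < r) by (intros; nra).
  unfold Arg; simpl.
  destruct (Rlt_dec 0 x) as [Hx|Hx].
  { specialize (U ltac:(lra)).
    destruct (cos_sin_atan_quot (x / r) (y / r)) as [Hc Hs].
    - now apply Rdiv_lt_0_compat.
    - field_simplify; [|lra]. replace (r ^ 2) with (x ^ 2 + y ^ 2) by lra. field. nra.
    - replace (y / r / (x / r)) with (y / x) in Hc, Hs by (field; lra).
      rewrite Hc, Hs. repeat split; try lra; field; lra. }
  destruct (Rlt_dec x 0) as [Hx'|Hx'].
  { specialize (U ltac:(lra)).
    destruct (cos_sin_atan_quot (- x / r) (- y / r)) as [Hc Hs].
    - apply Rdiv_lt_0_compat; lra.
    - field_simplify; [|lra]. replace (r ^ 2) with (x ^ 2 + y ^ 2) by lra. field. nra.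
    - replace (- y / r / (- x / r)) with (y / x) in Hc, Hs by (field; lra).
      destruct (Rle_dec 0 y) as [Hy|Hy].
      + rewrite neg_cos, neg_sin, Hc, Hs.
        assert (atan (y / x) <= 0).
        (* In the second quadrant [y / x <= 0], so adding [PI] does not push the angle above
           [PI]. *)
        { rewrite <- atan_0. destruct (Req_dec y 0) as [->|].
          - right. f_equal. field. lra.
          - left; apply atan_increasing. unfold Rdiv.
            pose proof (Rinv_lt_0_compat x Hx'). nra. }
        repeat split; try lra; field; lra.
      + rewrite cos_minus, sin_minus, cos_PI, sin_PI, Hc, Hs.
        assert (0 <= atan (y / x)).
        { rewrite <- atan_0. left; apply atan_increasing. unfold Rdiv.
          pose proof (Rinv_lt_0_compat x Hx'). nra. }
        repeat split; try lra; field; lra. }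
  assert (x = 0) by lra. subst x.
  destruct (Rlt_dec 0 y); [|destruct (Rlt_dec y 0)].
  - rewrite cos_PI2, sin_PI2. repeat split; try lra. nra.
  - rewrite cos_neg, sin_neg, cos_PI2, sin_PI2. repeat split; try lra. nra.
  - assert (y = 0) by lra. subst y. rewrite cos_0, sin_0. repeat split; try lra; nra.
Qed.

Lemma continuity_2d_pt_comp (f g1 g2 : R -> R -> R) (x y : R) :
  continuity_2d_pt f (g1 x y) (g2 x y) ->
  continuity_2d_pt g1 x y -> continuity_2d_pt g2 x y ->
  continuity_2d_pt (fun a b => f (g1 a b) (g2 a b)) x y.
Proof.
  intros Hf H1 H2 eps.
  destruct (Hf eps) as [d Hd]. destruct (H1 d) as [d1 Hd1]. destruct (H2 d) as [d2 Hd2].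
  exists (mkposreal _ (Rmin_stable_in_posreal d1 d2)). simpl. intros u v Hu Hv.
  pose proof (Rmin_l d1 d2). pose proof (Rmin_r d1 d2).
  apply Hd; [apply Hd1 | apply Hd2]; lra.
Qed.

Lemma continuity_2d_pt_sqnorm (x y : R) : continuity_2d_pt (fun a b => a ^ 2 + b ^ 2) x y.
Proof.
  apply (continuity_2d_pt_ext (fun a b => a * a + b * b)); [intros; ring|].
  apply continuity_2d_pt_plus; apply continuity_2d_pt_mult;
    (apply continuity_2d_pt_id1 || apply continuity_2d_pt_id2).
Qed.

Lemma continuity_2d_pt_scale (u : R -> R -> R) (s x y : R) :
  continuity_2d_pt u (s * x) (s * y) ->
  continuity_2d_pt (fun a b => u (s * a) (s * b)) x y.
Proof.
  intros H. apply (continuity_2d_pt_comp u (fun a _ => s * a) (fun _ b => s * b)).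
  - exact H.
  - apply continuity_2d_pt_mult. apply continuity_2d_pt_const. apply continuity_2d_pt_id1.
  - apply continuity_2d_pt_mult. apply continuity_2d_pt_const. apply continuity_2d_pt_id2.
Qed.

Lemma continuity_pt_ray (u : R -> R -> R) (t x y : R) :
  continuity_2d_pt u (t * x) (t * y) -> continuity_pt (fun s => u (s * x) (s * y)) t.
Proof.
  intros H eps Heps. destruct (H (mkposreal eps Heps)) as [d Hd]. simpl in Hd.
  pose proof (cond_pos d) as Hdp. set (k := Rabs x + Rabs y + 1).
  assert (Hk : 0 < k).
  { unfold k. pose proof (Rabs_pos x). pose proof (Rabs_pos y). lra. }
  exists (d / k). split; [now apply Rdiv_lt_0_compat|].
  intros s [_ Hs]. unfold R_dist in *. simpl in *. unfold R_dist in *.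
  assert (Hsk : Rabs (s - t) * k < d).
  { apply (Rmult_lt_compat_r k) in Hs; [|lra].
    unfold Rdiv in Hs. rewrite Rmult_assoc, Rinv_l in Hs; lra. }
  unfold k in Hsk.
  pose proof (Rabs_pos x). pose proof (Rabs_pos y). pose proof (Rabs_pos (s - t)).
  apply Hd; rewrite <- Rmult_minus_distr_r, Rabs_mult; nra.
Qed.

(** In polar coordinates the closed disc of radius [r] is the image of the rectangle [0, r] x
    [-PI, PI], where compactness gives uniform continuity. The two points compared lie on one ray,
    so they share the angle and only the radius varies. *)
Lemma radial_uniform_continuity (u : R -> R -> R) (r : R) :
  0 <= r < 1 ->
  (forall x y, x ^ 2 + y ^ 2 < 1 -> continuity_2d_pt u x y) ->
  forall eps : posreal, exists delta : posreal, forall x y s t,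
    x ^ 2 + y ^ 2 <= r ^ 2 -> 0 <= s <= 1 -> 0 <= t <= 1 -> Rabs (s - t) < delta ->
    Rabs (u (s * x) (s * y) - u (t * x) (t * y)) < eps.
Proof.
  intros Hr Hu eps.
  destruct (uniform_continuity_2d (fun p q => u (p * cos q) (p * sin q)) 0 r (- PI) PI)
    with (eps := eps) as [d Hd].
  { intros p q Hp Hq.
    apply (continuity_2d_pt_comp u (fun p q => p * cos q) (fun p q => p * sin q)).
    - apply Hu. pose proof (sin2_cos2 q). unfold Rsqr in *.
      replace ((p * cos q) ^ 2 + (p * sin q) ^ 2) with (p * p * (sin q * sin q + cos q * cos q))
        by ring. nra.
    - apply continuity_2d_pt_mult; [apply continuity_2d_pt_id1|].
      apply (continuity_1d_2d_pt_comp cos (fun _ b => b)).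
      apply continuity_cos. apply continuity_2d_pt_id2.
    - apply continuity_2d_pt_mult; [apply continuity_2d_pt_id1|].
      apply (continuity_1d_2d_pt_comp sin (fun _ b => b)).
      apply continuity_sin. apply continuity_2d_pt_id2. }
  exists d. intros x y s t Hxy Hs Ht Hst.
  destruct (polar_Arg x y) as [Hq [Ex Ey]].
  set (p := sqrt (x ^ 2 + y ^ 2)) in *. set (q := Arg (x, y)) in *.
  assert (Hp0 : 0 <= p) by apply sqrt_pos.
  assert (Hp : p <= r).
  { unfold p. rewrite <- (sqrt_pow2 r) by lra. apply sqrt_le_1_alt. lra. }
  assert (Hd' : Rabs (s * p - t * p) < d).
  { rewrite <- Rmult_minus_distr_r, Rabs_mult, (Rabs_pos_eq p Hp0).
    pose proof (Rabs_pos (s - t)). nra. }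
  rewrite Ex, Ey, <- !Rmult_assoc.
  apply (Hd (t * p) q (s * p) q); try lra; try nra.
  rewrite Rminus_diag, Rabs_R0. apply cond_pos.
Qed.

(** For unit vectors the scalar product is 1 minus half the squared distance, and here the squared
    distance is less than 2. *)
Lemma unit_vectors_close (a b c d : R) :
  a ^ 2 + b ^ 2 = 1 -> c ^ 2 + d ^ 2 = 1 -> Rabs (a - c) < 1 -> Rabs (b - d) < 1 ->
  0 < a * c + b * d.
Proof.
  intros H1 H2 H3 H4. apply Rabs_def2 in H3. apply Rabs_def2 in H4. nra.
Qed.

(** Each term is the angle of (u + i v)(t z) times the conjugate of (u + i v)(s z), for consecutive
    nodes [s], [t] on the ray through z = (x, y). Taking [atan] of imaginary over real part is
    correct as long as the real part stays positive. *)
Fixpoint radial_arg (u v : R -> R -> R) (h : R) (j : nat) (x y : R) : R :=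
  match j with
  | O => 0
  | S i =>
      let s := INR i * h in let t := INR (S i) * h in
      radial_arg u v h i x y +
      atan ((v (t * x) (t * y) * u (s * x) (s * y) - u (t * x) (t * y) * v (s * x) (s * y)) /
            (u (t * x) (t * y) * u (s * x) (s * y) + v (t * x) (t * y) * v (s * x) (s * y)))
  end.

Definition continuous_arg (u v : R -> R -> R) (r : R) (th : R -> R -> R) : Prop :=
  th 0 0 = 0 /\
  forall x y, x ^ 2 + y ^ 2 <= r ^ 2 ->
    continuity_2d_pt th x y /\ cos (th x y) = u x y /\ sin (th x y) = v x y.

(** Uniform continuity gives one number of radial steps that works for the whole closed disc. The
    argument is then a finite sum of continuous functions, hence continuous in both variables. *)
Lemma continuous_arg_closed_disc (u v : R -> R -> R) (r : R) :
  0 <= r < 1 ->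
  (forall x y, x ^ 2 + y ^ 2 < 1 -> continuity_2d_pt u x y) ->
  (forall x y, x ^ 2 + y ^ 2 < 1 -> continuity_2d_pt v x y) ->
  (forall x y, x ^ 2 + y ^ 2 < 1 -> u x y ^ 2 + v x y ^ 2 = 1) ->
  u 0 0 = 1 -> v 0 0 = 0 ->
  exists th, continuous_arg u v r th.
Proof.
  intros Hr Hu Hv Huv Hu0 Hv0.
  destruct (radial_uniform_continuity u r Hr Hu (mkposreal 1 Rlt_0_1)) as [d1 Hd1].
  destruct (radial_uniform_continuity v r Hr Hv (mkposreal 1 Rlt_0_1)) as [d2 Hd2].
  simpl in Hd1, Hd2.
  set (d := Rmin d1 d2). assert (Hd : 0 < d) by apply Rmin_stable_in_posreal.
  assert (Hdl : d <= d1) by apply Rmin_l. assert (Hdr : d <= d2) by apply Rmin_r.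
  (* Steps of length 1/N below [d] change [u] and [v] by less than 1, the tolerance of
     [unit_vectors_close]. *)
  destruct (archimed_cor1 d Hd) as [N [HN HN0]].
  assert (HNp : 0 < INR N) by now apply lt_0_INR.
  set (h := / INR N) in *. assert (Hh : 0 < h) by now apply Rinv_0_lt_compat.
  assert (HNh : INR N * h = 1) by (unfold h; field; lra).
  exists (radial_arg u v h N). split.
  - clearbody h. clear - Hu0 Hv0. induction N as [|i IH]; simpl; [reflexivity|].
    rewrite IH, !Rmult_0_r, Hu0, Hv0.
    replace ((0 * 1 - 1 * 0) / (1 * 1 + 0 * 0)) with 0 by field.
    rewrite atan_0; ring.
  - intros x y Hxy.
    assert (Hsc : forall s, 0 <= s <= 1 -> (s * x) ^ 2 + (s * y) ^ 2 < 1).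
    { intros s Hs. replace ((s * x) ^ 2 + (s * y) ^ 2) with (s * s * (x ^ 2 + y ^ 2)) by ring.
      assert (0 <= x ^ 2 + y ^ 2 < 1) by nra. assert (s * s <= 1) by nra.
      set (q := x ^ 2 + y ^ 2) in *. nra. }
    assert (Hj : forall j, (j <= N)%nat ->
      continuity_2d_pt (radial_arg u v h j) x y /\
      cos (radial_arg u v h j x y) = u (INR j * h * x) (INR j * h * y) /\
      sin (radial_arg u v h j x y) = v (INR j * h * x) (INR j * h * y)).
    { induction j as [|i IH]; intros Hj.
      - simpl. rewrite !Rmult_0_l, cos_0, sin_0. repeat split; auto.
        apply continuity_2d_pt_const.
      - destruct (IH ltac:(lia)) as [Hc [Ecos Esin]].
        cbn [radial_arg]. set (s := INR i * h) in *. set (t := INR (S i) * h) in *.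
        assert (Hi : INR (S i) <= INR N) by now apply le_INR.
        pose proof (pos_INR i) as Hi0.
        assert (Hts : t - s = h) by (unfold t, s; rewrite S_INR; ring).
        assert (Hs : 0 <= s) by (unfold s; nra).
        assert (Ht : t <= 1) by (unfold t; nra).
        assert (Habs : Rabs (t - s) < d) by (rewrite Hts, Rabs_pos_eq; lra).
        pose proof (Huv _ _ (Hsc s ltac:(lra))) as Us.
        pose proof (Huv _ _ (Hsc t ltac:(lra))) as Ut.
        assert (HP : 0 < u (t * x) (t * y) * u (s * x) (s * y) + v (t * x) (t * y) * v (s * x) (s * y)).
        { apply unit_vectors_close; auto; [apply Hd1 | apply Hd2]; lra. }
        split.
        + pose proof (Hsc s ltac:(lra)) as Ss. pose proof (Hsc t ltac:(lra)) as St.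
          pose proof (continuity_2d_pt_scale u s x y (Hu _ _ Ss)).
          pose proof (continuity_2d_pt_scale u t x y (Hu _ _ St)).
          pose proof (continuity_2d_pt_scale v s x y (Hv _ _ Ss)).
          pose proof (continuity_2d_pt_scale v t x y (Hv _ _ St)).
          apply continuity_2d_pt_plus; [exact Hc|].
          apply (continuity_1d_2d_pt_comp atan).
          { apply derivable_continuous_pt, derivable_pt_atan. }
          apply continuity_2d_pt_mult.
          * apply continuity_2d_pt_minus; now apply continuity_2d_pt_mult.
          * apply (continuity_2d_pt_inv (fun x y => u (t * x) (t * y) * u (s * x) (s * y) + v (t * x) (t * y) * v (s * x) (s * y))); [|lra].
            apply continuity_2d_pt_plus; now apply continuity_2d_pt_mult.
        (* The quotient of two unit numbers is again a unit number. Adding its angle to the angle at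
           [s] gives an angle at [t]. *)
        + destruct (cos_sin_atan_quot
            (u (t * x) (t * y) * u (s * x) (s * y) + v (t * x) (t * y) * v (s * x) (s * y))
            (v (t * x) (t * y) * u (s * x) (s * y) - u (t * x) (t * y) * v (s * x) (s * y))) as [Ac As].
          * exact HP.
          * transitivity ((u (t * x) (t * y) ^ 2 + v (t * x) (t * y) ^ 2) *
              (u (s * x) (s * y) ^ 2 + v (s * x) (s * y) ^ 2)); [ring|].
            rewrite Us, Ut; ring.
          * rewrite cos_plus, sin_plus, Ac, As, Ecos, Esin. split.
            -- transitivity (u (t * x) (t * y) * (u (s * x) (s * y) ^ 2 + v (s * x) (s * y) ^ 2)); [ring|].
               rewrite Us; ring.
            -- transitivity (v (t * x) (t * y) * (u (s * x) (s * y) ^ 2 + v (s * x) (s * y) ^ 2)); [ring|].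
               rewrite Us; ring. }
    destruct (Hj N (Nat.le_refl N)) as [H1 [H2 H3]].
    rewrite HNh, !Rmult_1_l in H2, H3. auto.
Qed.

Lemma cos_eq_1_small (a : R) : - PI <= a <= PI -> cos a = 1 -> a = 0.
Proof.
  intros Ha H. pose proof PI_RGT_0.
  destruct (Rtotal_order a 0) as [Hn|[?|Hp]]; auto; exfalso.
  - rewrite <- cos_neg in H. pose proof (cos_decreasing_1 0 (- a)). rewrite cos_0 in *. lra.
  - pose proof (cos_decreasing_1 0 a). rewrite cos_0 in *. lra.
Qed.

(** If [p 1] exceeded [PI], then [p] would take the value [PI], where the cosine is -1. Otherwise
    [p 1] is either below [- PI] or forced to be 0. The one-sided conclusion suffices, since it is
    applied to a difference in both orders. *)
Lemma continuous_multiple_2PI_nonpos (p : R -> R) :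
  (forall t, 0 <= t <= 1 -> continuity_pt p t) ->
  (forall t, 0 <= t <= 1 -> cos (p t) = 1) -> p 0 = 0 -> p 1 <= 0.
Proof.
  intros Hc H1 H0. pose proof PI_RGT_0.
  destruct (Rle_dec (p 1) PI) as [Hle|Hgt].
  - destruct (Rle_dec (- PI) (p 1)); [|lra].
    right; apply cos_eq_1_small; [lra | apply H1; lra].
  - destruct (IVT_interv (fun t => p t - PI) 0 1) as [t [Ht Et]]; try lra.
    + intros a Ha. apply continuity_pt_minus; [now apply Hc|].
      apply continuity_pt_const. intros ? ?; reflexivity.
    + specialize (H1 t Ht). replace (p t) with PI in H1 by lra. rewrite cos_PI in H1. lra.
Qed.

(** Along the radius to (x, y) the difference of the two arguments is continuous, a multiple of 2
    [PI], and zero at the origin. Exchanging the roles turns this into uniqueness. *)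
Lemma continuous_arg_le (u v : R -> R -> R) (r1 r2 : R) (th1 th2 : R -> R -> R) (x y : R) :
  continuous_arg u v r1 th1 -> continuous_arg u v r2 th2 ->
  x ^ 2 + y ^ 2 <= r1 ^ 2 -> x ^ 2 + y ^ 2 <= r2 ^ 2 -> th1 x y <= th2 x y.
Proof.
  intros [Z1 H1] [Z2 H2] Hx1 Hx2.
  assert (Hsc : forall t r, 0 <= t <= 1 -> x ^ 2 + y ^ 2 <= r ^ 2 ->
    (t * x) ^ 2 + (t * y) ^ 2 <= r ^ 2).
  { intros t r Ht Hr.
    replace ((t * x) ^ 2 + (t * y) ^ 2) with (t * t * (x ^ 2 + y ^ 2)) by ring.
    pose proof (pow2_ge_0 x). pose proof (pow2_ge_0 y). assert (t * t <= 1) by nra.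
    set (q := x ^ 2 + y ^ 2) in *. assert (0 <= q) by (unfold q; lra). nra. }
  pose proof (continuous_multiple_2PI_nonpos (fun t => th1 (t * x) (t * y) - th2 (t * x) (t * y))) as H.
  cbv beta in H. rewrite !Rmult_0_l, !Rmult_1_l in H.
  enough (th1 x y - th2 x y <= 0) by lra. apply H; [| |lra].
  - intros t Ht. apply continuity_pt_minus; apply continuity_pt_ray.
    + now apply H1, Hsc.
    + now apply H2, Hsc.
  - intros t Ht. destruct (H1 _ _ (Hsc t r1 Ht Hx1)) as [_ [C1' S1]].
    destruct (H2 _ _ (Hsc t r2 Ht Hx2)) as [_ [C2 S2]].
    rewrite cos_minus, C1', C2, S1, S2, <- C1', <- S1.
    pose proof (sin2_cos2 (th1 (t * x) (t * y))). unfold Rsqr in *. lra.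
Qed.

(** The arguments on closed discs of radius below 1 agree on common points by uniqueness, so they
    glue to one on the open disc. *)
Lemma continuous_arg_disc (u v : R -> R -> R) :
  (forall x y, x ^ 2 + y ^ 2 < 1 -> continuity_2d_pt u x y) ->
  (forall x y, x ^ 2 + y ^ 2 < 1 -> continuity_2d_pt v x y) ->
  (forall x y, x ^ 2 + y ^ 2 < 1 -> u x y ^ 2 + v x y ^ 2 = 1) ->
  u 0 0 = 1 -> v 0 0 = 0 ->
  exists th : R -> R -> R, th 0 0 = 0 /\
    forall x y, x ^ 2 + y ^ 2 < 1 ->
      continuity_2d_pt th x y /\ cos (th x y) = u x y /\ sin (th x y) = v x y.
Proof.
  intros Hu Hv Huv Hu0 Hv0.
  assert (Hex : forall r, exists th, 0 <= r < 1 -> continuous_arg u v r th).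
  { intros r. destruct (excluded_middle_informative (0 <= r < 1)) as [Hr|Hr].
    - destruct (continuous_arg_closed_disc u v r) as [th Hth]; auto. now exists th.
    (* A default for irrelevant radii, so that the choice below is made for every real [r]. *)
    - exists (fun _ _ => 0). tauto. }
  set (T := fun r => proj1_sig (constructive_indefinite_description _ (Hex r))).
  assert (HT : forall r, 0 <= r < 1 -> continuous_arg u v r (T r)).
  { intros r. exact (proj2_sig (constructive_indefinite_description _ (Hex r))). }
  (* The midpoint between the modulus and 1: the point lies strictly inside the disc of radius
     [rho], which therefore contains a neighbourhood of it. *)
  set (rho := fun x y => (1 + sqrt (x ^ 2 + y ^ 2)) / 2).
  assert (Hrho : forall x y, x ^ 2 + y ^ 2 < 1 ->
    0 <= rho x y < 1 /\ x ^ 2 + y ^ 2 < rho x y ^ 2).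
  { intros x y Hxy. unfold rho.
    assert (0 <= x ^ 2 + y ^ 2) by nra.
    pose proof (sqrt_pos (x ^ 2 + y ^ 2)). pose proof (sqrt_sqrt (x ^ 2 + y ^ 2) ltac:(auto)).
    assert (sqrt (x ^ 2 + y ^ 2) < 1) by nra. nra. }
  assert (Heq : forall r x y, 0 <= r < 1 -> x ^ 2 + y ^ 2 <= r ^ 2 -> T (rho x y) x y = T r x y).
  { intros r x y Hr Hxy. assert (H1 : x ^ 2 + y ^ 2 < 1) by nra.
    destruct (Hrho x y H1) as [Hr1 Hr2].
    apply Rle_antisym; eapply continuous_arg_le; eauto; lra. }
  exists (fun x y => T (rho x y) x y). split.
  - rewrite (Heq 0); try lra; try nra. apply (HT 0); lra.
  - intros x y Hxy. destruct (Hrho x y Hxy) as [Hr1 Hr2].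
    destruct (proj2 (HT _ Hr1) x y ltac:(lra)) as [Hc [Ec Es]].
    repeat split; auto.
    (* Near (x, y) the glued function coincides with the single argument chosen for the fixed radius
       [rho x y]. *)
    apply (continuity_2d_pt_ext_loc (T (rho x y))); [|exact Hc].
    pose proof (continuity_2d_pt_sqnorm x y) as Hq.
    assert (He : 0 < rho x y ^ 2 - (x ^ 2 + y ^ 2)) by lra.
    destruct (Hq (mkposreal _ He)) as [d Hd]. exists d. intros a b Ha Hb.
    specialize (Hd a b Ha Hb). simpl in Hd. apply Rabs_def2 in Hd.
    symmetry. apply Heq; [exact Hr1 | nra].
Qed.

(** * Complex derivatives and curves *)

Lemma in_disc_iff (x y : R) : in_disc (x, y) <-> x ^ 2 + y ^ 2 < 1.
Proof.
  unfold in_disc, Cnorm; cbn [fst snd].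
  assert (H : 0 <= x ^ 2 + y ^ 2) by nra.
  pose proof (sqrt_pos (x ^ 2 + y ^ 2)). pose proof (sqrt_sqrt _ H). nra.
Qed.

Lemma C_neq_0 (x y : R) : (x, y) <> C0 -> 0 < x ^ 2 + y ^ 2.
Proof.
  intros H. destruct (Req_dec x 0) as [->|Hx]; [|nra].
  destruct (Req_dec y 0) as [->|Hy]; [|nra]. now elim H.
Qed.

Lemma fst_le_Cnorm (z : Cplx) : Rabs (fst z) <= Cnorm z.
Proof.
  unfold Cnorm. rewrite <- sqrt_Rsqr_abs. apply sqrt_le_1_alt. unfold Rsqr. nra.
Qed.

Lemma snd_le_Cnorm (z : Cplx) : Rabs (snd z) <= Cnorm z.
Proof.
  unfold Cnorm. rewrite <- sqrt_Rsqr_abs. apply sqrt_le_1_alt. unfold Rsqr. nra.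
Qed.

Lemma Cnorm_le_sum (z : Cplx) : Cnorm z <= Rabs (fst z) + Rabs (snd z).
Proof.
  unfold Cnorm. pose proof (Rabs_pos (fst z)). pose proof (Rabs_pos (snd z)).
  rewrite <- (sqrt_pow2 (Rabs (fst z) + Rabs (snd z))) by lra. apply sqrt_le_1_alt.
  rewrite <- (pow2_abs (fst z)), <- (pow2_abs (snd z)). nra.
Qed.

Lemma Cnorm_mul (z w : Cplx) : Cnorm (Cmul z w) = Cnorm z * Cnorm w.
Proof.
  unfold Cnorm, Cmul; cbn [fst snd]. rewrite <- sqrt_mult by nra. f_equal. ring.
Qed.

Lemma locally_2d_disc (x y : R) :
  x ^ 2 + y ^ 2 < 1 -> locally_2d (fun a b => a ^ 2 + b ^ 2 < 1) x y.
Proof.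
  intros H.
  pose proof (continuity_2d_pt_sqnorm x y) as Hq.
  assert (He : 0 < 1 - (x ^ 2 + y ^ 2)) by lra.
  destruct (Hq (mkposreal _ He)) as [d Hd]. exists d. intros a b Ha Hb.
  specialize (Hd a b Ha Hb). simpl in Hd. apply Rabs_def2 in Hd. nra.
Qed.

(** The difference quotient multiplied out, with the error in the maximum norm that
    [differentiable_pt_lim] uses. *)
Lemma cderiv_increment (f : Cplx -> Cplx) (x y : R) (l : Cplx) :
  x ^ 2 + y ^ 2 < 1 -> has_cderiv f (x, y) l ->
  forall eps : posreal, locally_2d (fun a b =>
    Cnorm (Csub (Csub (f (a, b)) (f (x, y))) (Cmul l (a - x, b - y))) <=
    eps * Rmax (Rabs (a - x)) (Rabs (b - y))) x y.
Proof.
  intros Hxy Hf eps. pose proof (cond_pos eps) as He.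
  (* The modulus is at most twice the maximum norm, hence the factor 1/2. *)
  destruct (Hf (eps / 2)) as [d [Hd H]]; [lra|].
  destruct (locally_2d_disc x y Hxy) as [d' Hd'].
  pose proof (cond_pos d') as Hd'p.
  assert (Hm : 0 < Rmin (d / 2) d') by (apply Rmin_glb_lt; lra).
  exists (mkposreal _ Hm). simpl. intros a b Ha Hb.
  pose proof (Rmin_l (d / 2) d'). pose proof (Rmin_r (d / 2) d').
  assert (Hdisc : in_disc (a, b)) by (apply in_disc_iff, Hd'; lra).
  pose proof (Rmax_l (Rabs (a - x)) (Rabs (b - y))) as M1.
  pose proof (Rmax_r (Rabs (a - x)) (Rabs (b - y))) as M2.
  destruct (excluded_middle_informative ((a - x, b - y) = C0)) as [E|E].
  - injection E as E1 E2. replace a with x by lra. replace b with y by lra.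
    rewrite !Rminus_diag, Rabs_R0, Rmax_left by lra.
    unfold Cnorm, Csub, Cadd, Copp, Cmul; cbn [fst snd].
    match goal with |- sqrt ?e <= _ => replace e with 0 by ring end.
    rewrite sqrt_0. lra.
  - pose proof (Cnorm_le_sum (a - x, b - y)) as Hn. cbn [fst snd] in Hn.
    specialize (H (a - x, b - y) E ltac:(lra)).
    replace (Cadd (x, y) (a - x, b - y)) with (a, b) in H
      by (unfold Cadd; simpl; f_equal; ring).
    specialize (H Hdisc).
    apply C_neq_0 in E.
    replace (Csub (Csub (f (a, b)) (f (x, y))) (Cmul l (a - x, b - y))) with
      (Cmul (Csub (Cdiv (Csub (f (a, b)) (f (x, y))) (a - x, b - y)) l) (a - x, b - y)).
    + rewrite Cnorm_mul.
      assert (0 <= Cnorm (a - x, b - y)) by apply sqrt_pos.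
      assert (0 <= Cnorm (Csub (Cdiv (Csub (f (a, b)) (f (x, y))) (a - x, b - y)) l))
        by apply sqrt_pos. nra.
    + unfold Csub, Cdiv, Cadd, Copp, Cmul, Cinv; cbn [fst snd].
      f_equal; field; lra.
Qed.

(** The Cauchy-Riemann form of the differential: the real and imaginary parts of multiplication by
    [l]. *)
Lemma cderiv_differentiable (f : Cplx -> Cplx) (x y : R) (l : Cplx) :
  x ^ 2 + y ^ 2 < 1 -> has_cderiv f (x, y) l ->
  differentiable_pt_lim (fun a b => fst (f (a, b))) x y (fst l) (- snd l) /\
  differentiable_pt_lim (fun a b => snd (f (a, b))) x y (snd l) (fst l).
Proof.
  intros Hxy Hf. split; intros eps;
    destruct (cderiv_increment f x y l Hxy Hf eps) as [d Hd]; exists d; intros a b Ha Hb;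
    (eapply Rle_trans; [|apply (Hd a b Ha Hb)]).
  - eapply Rle_trans; [|apply fst_le_Cnorm]. right. f_equal.
    unfold Csub, Cadd, Copp, Cmul; cbn [fst snd]. ring.
  - eapply Rle_trans; [|apply snd_le_Cnorm]. right. f_equal.
    unfold Csub, Cadd, Copp, Cmul; cbn [fst snd]. ring.
Qed.

Lemma cderiv_continuity (f : Cplx -> Cplx) (x y : R) (l : Cplx) :
  x ^ 2 + y ^ 2 < 1 -> has_cderiv f (x, y) l ->
  continuity_2d_pt (fun a b => fst (f (a, b))) x y /\
  continuity_2d_pt (fun a b => snd (f (a, b))) x y.
Proof.
  intros Hxy Hf. destruct (cderiv_differentiable f x y l Hxy Hf).
  split; apply differentiable_continuity_pt; eexists; eexists; eauto.
Qed.

Lemma continuity_2d_pt_Cnorm (g : Cplx -> Cplx) (z : Cplx) :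
  continuity_2d_pt (fun a b => fst (g (a, b))) (fst z) (snd z) ->
  continuity_2d_pt (fun a b => snd (g (a, b))) (fst z) (snd z) ->
  forall eps : R, eps > 0 -> exists delta : R, delta > 0 /\
    forall w : Cplx, Cnorm (Csub w z) < delta -> Cnorm (Csub (g w) (g z)) < eps.
Proof.
  intros H1 H2 eps He. assert (He2 : 0 < eps / 2) by lra.
  destruct (H1 (mkposreal _ He2)) as [d1 Hd1]. destruct (H2 (mkposreal _ He2)) as [d2 Hd2].
  simpl in Hd1, Hd2. exists (Rmin d1 d2). split; [apply Rmin_stable_in_posreal|].
  intros [a b] Hw. destruct z as [x y]. cbn [fst snd] in *.
  pose proof (Rmin_l d1 d2). pose proof (Rmin_r d1 d2).
  assert (N1 : Rabs (a - x) <= Cnorm (Csub (a, b) (x, y))) by exact (fst_le_Cnorm (Csub (a, b) (x, y))).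
  assert (N2 : Rabs (b - y) <= Cnorm (Csub (a, b) (x, y))) by exact (snd_le_Cnorm (Csub (a, b) (x, y))).
  assert (N3 : Cnorm (Csub (g (a, b)) (g (x, y))) <=
    Rabs (fst (g (a, b)) - fst (g (x, y))) + Rabs (snd (g (a, b)) - snd (g (x, y))))
    by exact (Cnorm_le_sum (Csub (g (a, b)) (g (x, y)))).
  specialize (Hd1 a b ltac:(lra) ltac:(lra)). specialize (Hd2 a b ltac:(lra) ltac:(lra)). lra.
Qed.

Lemma derivable_pt_lim_loc (p q : R -> R) (t l : R) :
  locally t (fun s => p s = q s) -> derivable_pt_lim p t l -> derivable_pt_lim q t l.
Proof.
  intros He Hp. apply is_derive_Reals. apply is_derive_Reals in Hp.
  exact (is_derive_ext_loc p q t l He Hp).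
Qed.

(* [L + i Th] is a continuous logarithm of the curve [X + i Y]. *)
Lemma derivable_log_curve (X Y L Th : R -> R) (t X' Y' : R) :
  derivable_pt_lim X t X' -> derivable_pt_lim Y t Y' -> continuity_pt Th t ->
  locally t (fun s => X s = exp (L s) * cos (Th s) /\ Y s = exp (L s) * sin (Th s)) ->
  derivable_pt_lim L t ((X t * X' + Y t * Y') / (X t ^ 2 + Y t ^ 2)) /\
  derivable_pt_lim Th t ((X t * Y' - Y t * X') / (X t ^ 2 + Y t ^ 2)).
Proof.
  intros HX HY HT Hl.
  assert (HXi : is_derive X t X') by now apply is_derive_Reals.
  assert (HYi : is_derive Y t Y') by now apply is_derive_Reals.
  assert (DX : Derive (fun s => X s) t = X') by exact (is_derive_unique _ _ _ HXi).
  assert (DY : Derive (fun s => Y s) t = Y') by exact (is_derive_unique _ _ _ HYi).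
  destruct (locally_singleton _ _ Hl) as [EX EY].
  assert (Hsq : forall s, (exp (L s) * cos (Th s)) ^ 2 + (exp (L s) * sin (Th s)) ^ 2
                  = exp (2 * L s)).
  { intros s. replace (2 * L s) with (L s + L s) by ring. rewrite exp_plus.
    pose proof (sin2_cos2 (Th s)) as H2. unfold Rsqr in H2.
    transitivity (exp (L s) * exp (L s) * (sin (Th s) * sin (Th s) + cos (Th s) * cos (Th s)));
      [ring | rewrite H2; ring]. }
  assert (Hpos : 0 < X t ^ 2 + Y t ^ 2) by (rewrite EX, EY, Hsq; apply exp_pos).
  split.
  - apply (derivable_pt_lim_loc (fun s => / 2 * ln (X s ^ 2 + Y s ^ 2))).
    + revert Hl. apply filter_imp. intros s [E1 E2]. rewrite E1, E2, Hsq, ln_exp. field.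
    + apply is_derive_Reals.
      auto_derive.
      * repeat split; try (eexists; eassumption). lra.
      * rewrite DX, DY. field. lra.
  (* Near [t], continuity keeps [Th s - Th t] within [PI / 2]. There it equals the [atan] of the
     slope of the curve at [s] times the conjugate of its value at [t], an explicit differentiable
     function. *)
  - apply (derivable_pt_lim_loc (fun s => Th t +
      atan ((Y s * X t - X s * Y t) / (X s * X t + Y s * Y t)))).
    + assert (HP : locally t (fun s => Rabs (Th s - Th t) < PI / 2)).
      { assert (Hp2 : PI / 2 > 0) by (pose proof PI_RGT_0; lra).
        destruct (HT (PI / 2) Hp2) as [d [Hd H]].
        exists (mkposreal d Hd). intros s Hs.
        destruct (Req_dec t s) as [<-|Hn].
        - rewrite Rminus_diag, Rabs_R0. lra.
        - apply H. split; [split; [exact I | auto] |]. exact Hs. }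
      generalize (filter_and _ _ HP Hl). apply filter_imp.
      intros s [H1 [E1 E2]]. apply Rabs_def2 in H1.
      assert (Hc : 0 < cos (Th s - Th t)) by (apply cos_gt_0; lra).
      pose proof (exp_pos (L s)). pose proof (exp_pos (L t)).
      replace ((Y s * X t - X s * Y t) / (X s * X t + Y s * Y t)) with (tan (Th s - Th t)).
      * rewrite atan_tan by lra. ring.
      * unfold tan. rewrite E1, E2, EX, EY.
        rewrite sin_minus. rewrite cos_minus in *. field.
        split; [|lra].
        match goal with |- ?e <> 0 => replace e with
          (exp (L s) * exp (L t) * (cos (Th s) * cos (Th t) + sin (Th s) * sin (Th t))) by ring end.
        apply Rgt_not_eq. apply Rmult_lt_0_compat; [nra | exact Hc].
    + apply is_derive_Reals.
      assert (Hne : X t * X t + Y t * Y t <> 0) by lra.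
      auto_derive.
      * repeat split; try (eexists; eassumption). exact Hne.
      * rewrite DX, DY.
        replace (Y t * X t + - (X t * Y t)) with 0 by ring. field.
        lra.
Qed.

(** * A continuous logarithm of f(z)/z *)

Lemma continuous_log_disc (k1 k2 : R -> R -> R) :
  (forall x y, x ^ 2 + y ^ 2 < 1 -> continuity_2d_pt k1 x y) ->
  (forall x y, x ^ 2 + y ^ 2 < 1 -> continuity_2d_pt k2 x y) ->
  (forall x y, x ^ 2 + y ^ 2 < 1 -> 0 < k1 x y ^ 2 + k2 x y ^ 2) ->
  k1 0 0 = 1 -> k2 0 0 = 0 ->
  exists g1 g2 : R -> R -> R, g1 0 0 = 0 /\ g2 0 0 = 0 /\
    forall x y, x ^ 2 + y ^ 2 < 1 ->
      continuity_2d_pt g1 x y /\ continuity_2d_pt g2 x y /\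
      exp (g1 x y) * cos (g2 x y) = k1 x y /\ exp (g1 x y) * sin (g2 x y) = k2 x y.
Proof.
  intros H1 H2 Hp E1 E2.
  (* The logarithm of the modulus. Multiplying by [exp (- g1)] normalises k to modulus 1, and
     [continuous_arg_disc] then gives the imaginary part. *)
  set (g1 := fun x y => / 2 * ln (k1 x y ^ 2 + k2 x y ^ 2)).
  assert (Hg1 : forall x y, x ^ 2 + y ^ 2 < 1 -> continuity_2d_pt g1 x y).
  { intros x y Hxy. apply continuity_2d_pt_mult; [apply continuity_2d_pt_const|].
    apply (continuity_1d_2d_pt_comp ln).
    - apply derivable_continuous_pt. eexists. apply derivable_pt_lim_ln, Hp, Hxy.
    - apply (continuity_2d_pt_comp (fun a b => a ^ 2 + b ^ 2)); auto.
      apply continuity_2d_pt_sqnorm. }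
  assert (Hexp : forall x y, x ^ 2 + y ^ 2 < 1 ->
    exp (- g1 x y) * exp (- g1 x y) * (k1 x y ^ 2 + k2 x y ^ 2) = 1).
  { intros x y Hxy. rewrite <- exp_plus.
    rewrite <- (exp_ln (k1 x y ^ 2 + k2 x y ^ 2)) by auto.
    rewrite <- exp_plus, <- exp_0. f_equal. unfold g1. field. }
  assert (Hg0 : g1 0 0 = 0).
  { unfold g1. rewrite E1, E2. replace (1 ^ 2 + 0 ^ 2) with 1 by ring. rewrite ln_1; ring. }
  assert (Hce : forall x y, x ^ 2 + y ^ 2 < 1 -> continuity_2d_pt (fun a b => exp (- g1 a b)) x y).
  { intros x y Hxy. apply (continuity_1d_2d_pt_comp exp (fun a b => - g1 a b)).
    - apply derivable_continuous_pt, derivable_pt_exp.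
    - apply continuity_2d_pt_opp; auto. }
  destruct (continuous_arg_disc (fun x y => k1 x y * exp (- g1 x y))
    (fun x y => k2 x y * exp (- g1 x y))) as [g2 [Hg2 H]].
  - intros x y Hxy. apply continuity_2d_pt_mult; auto.
  - intros x y Hxy. apply continuity_2d_pt_mult; auto.
  - intros x y Hxy. rewrite <- (Hexp x y Hxy). ring.
  - rewrite Hg0, E1, Ropp_0, exp_0. ring.
  - rewrite E2. ring.
  - exists g1, g2. repeat split; auto; destruct (H x y) as [Hc [Ec Es]]; auto.
    + rewrite Ec, exp_Ropp. field. apply Rgt_not_eq, exp_pos.
    + rewrite Es, exp_Ropp. field. apply Rgt_not_eq, exp_pos.
Qed.

Lemma Cdiv_sqnorm (a b x y : R) : 0 < x ^ 2 + y ^ 2 ->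
  fst (Cdiv (a, b) (x, y)) ^ 2 + snd (Cdiv (a, b) (x, y)) ^ 2 = (a ^ 2 + b ^ 2) / (x ^ 2 + y ^ 2).
Proof. intros H. unfold Cdiv, Cmul, Cinv; cbn [fst snd]. field. lra. Qed.

Lemma Cdiv_continuity (f : Cplx -> Cplx) (x y : R) :
  0 < x ^ 2 + y ^ 2 ->
  continuity_2d_pt (fun a b => fst (f (a, b))) x y ->
  continuity_2d_pt (fun a b => snd (f (a, b))) x y ->
  continuity_2d_pt (fun a b => fst (Cdiv (f (a, b)) (a, b))) x y /\
  continuity_2d_pt (fun a b => snd (Cdiv (f (a, b)) (a, b))) x y.
Proof.
  intros H H1 H2.
  assert (Hi : continuity_2d_pt (fun a b => / (a ^ 2 + b ^ 2)) x y).
  { apply (continuity_2d_pt_inv (fun a b => a ^ 2 + b ^ 2)); [|lra].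
    apply continuity_2d_pt_sqnorm. }
  assert (Hx : continuity_2d_pt (fun a b => a / (a ^ 2 + b ^ 2)) x y).
  { apply continuity_2d_pt_mult; [apply continuity_2d_pt_id1 | exact Hi]. }
  assert (Hy : continuity_2d_pt (fun a b => - b / (a ^ 2 + b ^ 2)) x y).
  { apply continuity_2d_pt_mult; [|exact Hi].
    apply continuity_2d_pt_opp, continuity_2d_pt_id2. }
  unfold Cdiv, Cmul, Cinv; cbn [fst snd]. split.
  - apply continuity_2d_pt_minus; apply continuity_2d_pt_mult; assumption.
  - apply continuity_2d_pt_plus; apply continuity_2d_pt_mult; assumption.
Qed.

(** The singularity of f(z)/z at the origin is removable with value f'(0) = 1, and the extended
    quotient has no zero. The origin is excluded from the last equation because [Cdiv] by [C0]
    yields [C0], which is not an exponential. *)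
Lemma A1_log_quotient (f f' : Cplx -> Cplx) :
  in_A1 f f' -> (forall z, in_disc z -> z <> C0 -> f z <> C0) ->
  exists g1 g2 : R -> R -> R, g1 0 0 = 0 /\ g2 0 0 = 0 /\
    forall x y, x ^ 2 + y ^ 2 < 1 ->
      continuity_2d_pt g1 x y /\ continuity_2d_pt g2 x y /\
      ((x, y) <> C0 -> Cexp (g1 x y, g2 x y) = Cdiv (f (x, y)) (x, y)).
Proof.
  intros [Hf [Hf0 Hf'0]] Hnz.
  set (k := fun z => if excluded_middle_informative (z = C0) then C1 else Cdiv (f z) z).
  assert (Hk0 : k C0 = C1).
  { unfold k. destruct (excluded_middle_informative (C0 = C0)); tauto. }
  assert (Hk : forall z, z <> C0 -> k z = Cdiv (f z) z).
  { intros z Hz. unfold k. destruct (excluded_middle_informative (z = C0)); tauto. }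
  (* As f(0) = 0, the quotient is the difference quotient of [f] at the origin, so its continuity
     there is the derivative condition itself. *)
  assert (Hcont0 : forall eps : posreal, locally_2d (fun a b => Cnorm (Csub (k (a, b)) C1) < eps) 0 0).
  { intros eps. pose proof (cond_pos eps) as He.
    assert (D0 : in_disc C0) by (apply in_disc_iff; lra).
    specialize (Hf C0 D0). rewrite Hf'0 in Hf. destruct (Hf eps He) as [d [Hd H]].
    assert (Hm : 0 < Rmin (d / 2) (1 / 2)) by (apply Rmin_glb_lt; lra).
    exists (mkposreal _ Hm). simpl. intros a b Ha Hb. rewrite Rminus_0_r in Ha, Hb.
    pose proof (Rmin_l (d / 2) (1 / 2)). pose proof (Rmin_r (d / 2) (1 / 2)).
    pose proof (Cnorm_le_sum (a, b)) as Hn. cbn [fst snd] in Hn.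
    destruct (excluded_middle_informative ((a, b) = C0)) as [E|E].
    - rewrite E, Hk0. unfold Csub, Cadd, Copp, C1, Cnorm; cbn [fst snd].
      match goal with |- sqrt ?e < _ => replace e with 0 by ring end.
      rewrite sqrt_0. exact He.
    - rewrite (Hk _ E). specialize (H (a, b) E ltac:(lra)).
      replace (Cadd C0 (a, b)) with (a, b) in H
        by (unfold Cadd, C0; cbn [fst snd]; f_equal; ring).
      rewrite Hf0 in H.
      replace (Csub (f (a, b)) C0) with (f (a, b)) in H.
      + apply H. unfold in_disc. lra.
      + destruct (f (a, b)). unfold Csub, Cadd, Copp, C0; cbn [fst snd]. f_equal; ring. }
  assert (Hkc : forall x y, x ^ 2 + y ^ 2 < 1 ->
    continuity_2d_pt (fun a b => fst (k (a, b))) x y /\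
    continuity_2d_pt (fun a b => snd (k (a, b))) x y).
  { intros x y Hxy. destruct (excluded_middle_informative ((x, y) = C0)) as [E|E].
    - injection E as -> ->. change (0, 0) with C0.
      split; intros eps; destruct (Hcont0 eps) as [d Hd]; exists d; intros a b Ha Hb;
        specialize (Hd a b Ha Hb); change (0, 0) with C0; rewrite Hk0;
        (eapply Rle_lt_trans; [|exact Hd]).
      + exact (fst_le_Cnorm (Csub (k (a, b)) C1)).
      + exact (snd_le_Cnorm (Csub (k (a, b)) C1)).
    - pose proof (C_neq_0 x y E) as Hp.
      destruct (cderiv_continuity f x y (f' (x, y)) Hxy) as [C1' C2'].
      { apply Hf, in_disc_iff, Hxy. }
      destruct (Cdiv_continuity f x y Hp C1' C2') as [D1 D2].
      assert (Hl : locally_2d (fun a b => Cdiv (f (a, b)) (a, b) = k (a, b)) x y).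
      { destruct (continuity_2d_pt_neq_0 (fun a b => a ^ 2 + b ^ 2) x y) as [d Hd].
        - apply continuity_2d_pt_sqnorm.
        - lra.
        - exists d. intros a b Ha Hb. symmetry; apply Hk. intros E'. injection E' as -> ->.
          apply (Hd 0 0 Ha Hb). ring. }
      split; [apply (continuity_2d_pt_ext_loc (fun a b => fst (Cdiv (f (a, b)) (a, b))))
             |apply (continuity_2d_pt_ext_loc (fun a b => snd (Cdiv (f (a, b)) (a, b))))];
        auto; destruct Hl as [d Hd]; exists d; intros a b Ha Hb; now rewrite (Hd a b Ha Hb). }
  destruct (continuous_log_disc (fun a b => fst (k (a, b))) (fun a b => snd (k (a, b))))
    as [g1 [g2 [Hg1 [Hg2 H]]]].
  - intros x y Hxy. now apply Hkc.
  - intros x y Hxy. now apply Hkc.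
  - intros x y Hxy. destruct (excluded_middle_informative ((x, y) = C0)) as [E|E].
    + rewrite E, Hk0. unfold C1; cbn [fst snd]. lra.
    + pose proof (Hnz _ (proj2 (in_disc_iff x y) Hxy) E) as Hfz.
      rewrite (Hk _ E). destruct (f (x, y)) as [a b].
      apply C_neq_0 in Hfz. apply C_neq_0 in E. rewrite Cdiv_sqnorm by assumption.
      now apply Rdiv_lt_0_compat.
  - change (0, 0) with C0. now rewrite Hk0.
  - change (0, 0) with C0. now rewrite Hk0.
  - exists g1, g2. split; [exact Hg1|]. split; [exact Hg2|]. intros x y Hxy.
    destruct (H x y Hxy) as [A1' [A2 [A3 A4]]]. repeat split; auto.
    intros E. rewrite <- (Hk _ E). unfold Cexp; cbn [fst snd]. rewrite A3, A4.
    now destruct (k (x, y)).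
Qed.

(** * The sector condition in logarithmic coordinates *)

(** After rotation by -lambda the angle [tau] of [z] satisfies |tau| < beta, and both sin(beta -
    tau) and sin(beta + tau) are positive. This replaces the condition on [Arg] by two linear
    inequalities, which survive integration along a segment. *)
Lemma sector_tan (z : Cplx) (lambda beta : R) :
  0 < beta < PI / 2 -> Rabs (Arg z - lambda) < beta ->
  Rabs (cos lambda * snd z - sin lambda * fst z) <=
  tan beta * (cos lambda * fst z + sin lambda * snd z).
Proof.
  intros Hb Ha. destruct z as [x y]. cbn [fst snd].
  destruct (polar_Arg x y) as [_ [Ex Ey]].
  set (r := sqrt (x ^ 2 + y ^ 2)) in *. assert (Hr : 0 <= r) by apply sqrt_pos.
  set (A := Arg (x, y)) in *. apply Rabs_def2 in Ha. set (tau := A - lambda) in *.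
  replace (cos lambda * y - sin lambda * x) with (r * sin tau)
    by (rewrite Ex, Ey; unfold tau; rewrite sin_minus; ring).
  replace (cos lambda * x + sin lambda * y) with (r * cos tau)
    by (rewrite Ex, Ey; unfold tau; rewrite cos_minus; ring).
  assert (Hc : 0 < cos beta) by (apply cos_gt_0; lra).
  assert (H1 : 0 < sin (beta - tau)) by (apply sin_gt_0; lra).
  assert (H2 : 0 < sin (beta + tau)) by (apply sin_gt_0; lra).
  rewrite sin_minus in H1. rewrite sin_plus in H2.
  assert (Hs : Rabs (sin tau) <= tan beta * cos tau).
  { apply Rmult_le_reg_l with (cos beta); [exact Hc|].
    replace (cos beta * (tan beta * cos tau)) with (sin beta * cos tau)
      by (unfold tan; field; lra).
    rewrite <- (Rabs_pos_eq (cos beta)) at 1 by lra. rewrite <- Rabs_mult.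
    apply Rabs_le. lra. }
  rewrite Rabs_mult, (Rabs_pos_eq r Hr). nra.
Qed.

Lemma nondecreasing_derive (p dp : R -> R) :
  (forall t, 0 <= t <= 1 -> derivable_pt_lim p t (dp t)) ->
  (forall t, 0 <= t <= 1 -> 0 <= dp t) -> p 0 <= p 1.
Proof.
  intros Hd Hp.
  destruct (MVT_gen p 0 1 dp) as [c [Hc E]].
  - rewrite Rmin_left, Rmax_right by lra. intros x Hx. apply is_derive_Reals, Hd. lra.
  - rewrite Rmin_left, Rmax_right by lra. intros x Hx.
    apply derivable_continuous_pt. exists (dp x). now apply Hd.
  - rewrite Rmin_left, Rmax_right in Hc by lra. specialize (Hp c Hc). lra.
Qed.

(* With [D = d1 + i d2], both components below come from [conj D * exp (- i lambda) * F]. *)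
Lemma sector_increment (L Th : R -> R) (p : R -> Cplx) (d1 d2 lambda T : R) :
  (forall t, 0 <= t <= 1 -> derivable_pt_lim L t (fst (Cmul (p t) (d1, d2)))) ->
  (forall t, 0 <= t <= 1 -> derivable_pt_lim Th t (snd (Cmul (p t) (d1, d2)))) ->
  (forall t, 0 <= t <= 1 ->
    Rabs (cos lambda * snd (p t) - sin lambda * fst (p t)) <=
    T * (cos lambda * fst (p t) + sin lambda * snd (p t))) ->
  let X1 := cos lambda * (L 1 - L 0) + sin lambda * (Th 1 - Th 0) in
  let X2 := cos lambda * (Th 1 - Th 0) - sin lambda * (L 1 - L 0) in
  Rabs (d1 * X2 - d2 * X1) <= T * (d1 * X1 + d2 * X2).
Proof.
  intros HL HT Hp X1 X2.
  (* The sector is an intersection of two half-planes. For each one, a real linear combination of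
     [L] and [Th] has nonnegative derivative. *)
  assert (Hlin : forall a b, (forall t, 0 <= t <= 1 ->
      0 <= a * fst (Cmul (p t) (d1, d2)) + b * snd (Cmul (p t) (d1, d2))) ->
      0 <= a * (L 1 - L 0) + b * (Th 1 - Th 0)).
  { intros a b Hab.
    pose proof (nondecreasing_derive (fun t => a * L t + b * Th t) _
      (fun t Ht => derivable_pt_lim_plus _ _ _ _ _
         (derivable_pt_lim_scal _ a _ _ (HL t Ht)) (derivable_pt_lim_scal _ b _ _ (HT t Ht))) Hab).
    cbv beta in *. lra. }
  set (c := cos lambda) in *. set (s := sin lambda) in *.
  assert (Hpos : 0 <= d1 ^ 2 + d2 ^ 2) by nra.
  apply Rabs_le. split.
  (* With q = exp(-i lambda) p, these coefficients make the derivative equal to |D|^2 (T Re q + Im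
     q). The second case has the opposite sign of Im q. *)
  - pose proof (Hlin (T * (d1 * c - d2 * s) - d1 * s - d2 * c)
      (T * (d1 * s + d2 * c) + d1 * c - d2 * s)) as H.
    enough (0 <= T * (d1 * X1 + d2 * X2) + (d1 * X2 - d2 * X1)) by lra.
    unfold X1, X2. eapply Rle_trans; [apply H | right; ring].
    intros t Ht. specialize (Hp t Ht). apply Rabs_le_between in Hp.
    eapply Rle_trans; [apply Rmult_le_pos; [exact Hpos|]|].
    2: { right. unfold Cmul; cbn [fst snd].
      instantiate (1 := T * (c * fst (p t) + s * snd (p t)) + (c * snd (p t) - s * fst (p t))). ring. }
    lra.
  - pose proof (Hlin (T * (d1 * c - d2 * s) + d1 * s + d2 * c)
      (T * (d1 * s + d2 * c) - d1 * c + d2 * s)) as H.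
    enough (0 <= T * (d1 * X1 + d2 * X2) - (d1 * X2 - d2 * X1)) by lra.
    unfold X1, X2. eapply Rle_trans; [apply H | right; ring].
    intros t Ht. specialize (Hp t Ht). apply Rabs_le_between in Hp.
    eapply Rle_trans; [apply Rmult_le_pos; [exact Hpos|]|].
    2: { right. unfold Cmul; cbn [fst snd].
      instantiate (1 := T * (c * fst (p t) + s * snd (p t)) - (c * snd (p t) - s * fst (p t))). ring. }
    lra.
Qed.

(* Two sectors of opening less than [PI], turned apart by more than that opening, meet in a
   bounded set. *)
Lemma two_sectors_bounded (T S d L K X1 X2 Y1 Y2 : R) :
  0 < T -> 0 <= d <= S -> L = S * T + 1 ->
  Rabs (d * X2 - L * X1) <= T * (d * X1 + L * X2) ->
  Rabs (d * Y2 - - L * Y1) <= T * (d * Y1 + - L * Y2) ->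
  X2 - Y2 <= K ->
  Rabs X1 <= (S + L * T) * K /\ Rabs X2 <= (L + S * T) * K.
Proof.
  intros HT Hd HL HX HY HK.
  (* With D = d + i L, these are the components of conj(D) X and D Y. The hypotheses say that both
     lie in the sector |y| <= T x. *)
  set (x1 := d * X1 + L * X2) in *. set (y1 := d * X2 - L * X1) in *.
  set (x2 := d * Y1 + - L * Y2) in *. set (y2 := d * Y2 - - L * Y1) in *.
  set (N := d * d + L * L).
  assert (L1 : 1 <= L) by nra. assert (HN : 0 < N) by (unfold N; nra).
  pose proof (Rabs_pos y1). pose proof (Rabs_pos y2).
  assert (Hx1 : 0 <= x1) by nra. assert (Hx2 : 0 <= x2) by nra.
  apply Rabs_le_between in HX. apply Rabs_le_between in HY.
  (* This is what [L = S * T + 1] is chosen for. In [E] below, |y| <= T x bounds the right side from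
     below by (L - d T)(x1 + x2), so [x1] is at most N K. *)
  assert (Hgap : 1 <= L - d * T) by nra.
  assert (E : N * (X2 - Y2) = L * (x1 + x2) + d * (y1 - y2)).
  { unfold N, x1, x2, y1, y2. ring. }
  assert (B : x1 <= N * K).
  { assert ((L - d * T) * (x1 + x2) <= N * (X2 - Y2)) by (rewrite E; nra). nra. }
  assert (E1 : N * X1 = d * x1 - L * y1) by (unfold N, x1, y1; ring).
  assert (E2 : N * X2 = L * x1 + d * y1) by (unfold N, x1, y1; ring).
  assert (HK0 : 0 <= K) by nra.
  split; apply Rabs_le.
  - assert (0 <= (S - d) * (N * K)) by (apply Rmult_le_pos; nra).
    assert ((d + L * T) * x1 <= (d + L * T) * (N * K)) by (apply Rmult_le_compat_l; nra).
    assert (- ((d + L * T) * x1) <= N * X1 <= (d + L * T) * x1) by (rewrite E1; nra).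
    split; apply Rmult_le_reg_l with N; nra.
  - assert (0 <= (S - d) * T * (N * K)) by (apply Rmult_le_pos; nra).
    assert ((L + d * T) * x1 <= (L + d * T) * (N * K)) by (apply Rmult_le_compat_l; nra).
    assert (- ((L + d * T) * x1) <= N * X2 <= (L + d * T) * x1) by (rewrite E2; nra).
    split; apply Rmult_le_reg_l with N; nra.
Qed.

(** On the segment w = (s0 + t d1) + i (y0 + t d2) put z = exp w. Then f(z) = exp(w + g(z)), so w +
    g(z) is a continuous logarithm of the curve f(z). As dz/dt = z (d1 + i d2), its derivative is z
    f'(z)/f(z) times d1 + i d2. *)
Lemma derivable_log_segment (f : Cplx -> Cplx) (l : Cplx) (g1 g2 : R -> R -> R) (s0 y0 d1 d2 t : R) :
  s0 + t * d1 < 0 ->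
  (forall x y, x ^ 2 + y ^ 2 < 1 ->
      continuity_2d_pt g1 x y /\ continuity_2d_pt g2 x y /\
      ((x, y) <> C0 -> Cexp (g1 x y, g2 x y) = Cdiv (f (x, y)) (x, y))) ->
  let zx := fun t => exp (s0 + t * d1) * cos (y0 + t * d2) in
  let zy := fun t => exp (s0 + t * d1) * sin (y0 + t * d2) in
  has_cderiv f (zx t, zy t) l -> f (zx t, zy t) <> C0 ->
  let p := Cdiv (Cmul (zx t, zy t) l) (f (zx t, zy t)) in
  derivable_pt_lim (fun t => s0 + t * d1 + g1 (zx t) (zy t)) t (fst (Cmul p (d1, d2))) /\
  derivable_pt_lim (fun t => y0 + t * d2 + g2 (zx t) (zy t)) t (snd (Cmul p (d1, d2))).
Proof.
  intros Hs Hg zx zy Hf Hnz p.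
  assert (Hn : forall a, zx a ^ 2 + zy a ^ 2 = exp (s0 + a * d1) * exp (s0 + a * d1)).
  { intros a. unfold zx, zy. pose proof (sin2_cos2 (y0 + a * d2)) as H. unfold Rsqr in H.
    match goal with |- _ = ?e => transitivity (e * 1); [rewrite <- H|]; ring end. }
  assert (Hdisc : forall a, s0 + a * d1 < 0 -> zx a ^ 2 + zy a ^ 2 < 1).
  { intros a Ha. rewrite Hn. pose proof (exp_pos (s0 + a * d1)).
    apply exp_increasing in Ha. rewrite exp_0 in Ha. nra. }
  assert (Hz0 : forall a, (zx a, zy a) <> C0).
  { intros a E. injection E as E1 E2. specialize (Hn a). rewrite E1, E2 in Hn.
    pose proof (exp_pos (s0 + a * d1)). nra. }
  assert (Dzx : derivable_pt_lim zx t (d1 * zx t - d2 * zy t)).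
  { apply is_derive_Reals. unfold zx, zy. auto_derive; [exact I | ring]. }
  assert (Dzy : derivable_pt_lim zy t (d1 * zy t + d2 * zx t)).
  { apply is_derive_Reals. unfold zx, zy. auto_derive; [exact I | ring]. }
  destruct (cderiv_differentiable f _ _ l (Hdisc t Hs) Hf) as [Du Dv].
  pose proof (derivable_pt_lim_comp_2d _ zx zy t _ _ _ _ Du Dzx Dzy) as DX.
  pose proof (derivable_pt_lim_comp_2d _ zx zy t _ _ _ _ Dv Dzx Dzy) as DY.
  cbv beta in DX, DY.
  assert (Hloc : locally t (fun a => s0 + a * d1 < 0)).
  { assert (Hc : continuity_pt (fun a => s0 + a * d1) t).
    { apply derivable_continuous_pt. exists d1. apply is_derive_Reals.
      auto_derive; [exact I | ring]. }
    apply continuity_pt_locally with (eps := mkposreal (- (s0 + t * d1)) ltac:(lra)) in Hc.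
    revert Hc. apply filter_imp. intros a Ha. simpl in Ha. apply Rabs_def2 in Ha. lra. }
  assert (CT : continuity_pt (fun a => y0 + a * d2 + g2 (zx a) (zy a)) t).
  { apply continuity_pt_plus.
    - apply derivable_continuous_pt. exists d2. apply is_derive_Reals.
      auto_derive; [exact I | ring].
    - apply continuity_pt_locally. intros eps.
      destruct (proj1 (proj2 (Hg _ _ (Hdisc t Hs))) eps) as [d Hd].
      assert (Cx : continuity_pt zx t) by (apply derivable_continuous_pt; eexists; exact Dzx).
      assert (Cy : continuity_pt zy t) by (apply derivable_continuous_pt; eexists; exact Dzy).
      pose proof (proj1 (continuity_pt_locally zx t) Cx d) as Lx.
      pose proof (proj1 (continuity_pt_locally zy t) Cy d) as Ly.
      generalize (filter_and _ _ Lx Ly). apply filter_imp. intros a [Ha Hb]. now apply Hd. }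
  destruct (derivable_log_curve _ _ (fun a => s0 + a * d1 + g1 (zx a) (zy a)) _ t _ _ DX DY CT)
    as [R1 R2].
  - revert Hloc. apply filter_imp. intros a Ha.
    pose proof (proj2 (proj2 (Hg _ _ (Hdisc a Ha))) (Hz0 a)) as He.
    assert (Hm : f (zx a, zy a) = Cmul (Cexp (g1 (zx a) (zy a), g2 (zx a) (zy a))) (zx a, zy a)).
    { rewrite He. pose proof (C_neq_0 _ _ (Hz0 a)). destruct (f (zx a, zy a)).
      unfold Cdiv, Cmul, Cinv; cbn [fst snd]. f_equal; field; lra. }
    rewrite Hm. unfold Cexp, Cmul; cbn [fst snd].
    generalize (g1 (zx a) (zy a)) (g2 (zx a) (zy a)). intros G1 G2.
    rewrite exp_plus, (cos_plus (y0 + a * d2) G2), (sin_plus (y0 + a * d2) G2).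
    unfold zx, zy. split; ring.
  - unfold p. destruct (f (zx t, zy t)) as [u v]. apply C_neq_0 in Hnz. cbn [fst snd] in R1, R2.
    split.
    + match type of R1 with derivable_pt_lim _ _ ?e =>
        replace (fst _) with e; [exact R1|] end.
      unfold Cdiv, Cmul, Cinv; cbn [fst snd]. field. lra.
    + match type of R2 with derivable_pt_lim _ _ ?e =>
        replace (snd _) with e; [exact R2|] end.
      unfold Cdiv, Cmul, Cinv; cbn [fst snd]. field. lra.
Qed.

(** The left half-plane is convex, so the whole segment maps into the punctured disc and the sector
    condition holds along it. The heights [y0] and [y0 + d2] are arbitrary reals, not principal
    arguments. *)
Lemma spirallike_log_increment (f f' : Cplx -> Cplx) (lambda beta : R) (g1 g2 : R -> R -> R) :
  0 < beta < PI / 2 -> in_A1 f f' ->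
  (forall z, in_disc z -> z <> C0 ->
    f z <> C0 /\ Rabs (Arg (Cdiv (Cmul z (f' z)) (f z)) - lambda) < beta) ->
  (forall x y, x ^ 2 + y ^ 2 < 1 ->
      continuity_2d_pt g1 x y /\ continuity_2d_pt g2 x y /\
      ((x, y) <> C0 -> Cexp (g1 x y, g2 x y) = Cdiv (f (x, y)) (x, y))) ->
  forall s0 y0 d1 d2, s0 < 0 -> s0 + d1 < 0 ->
  let G1 := fun s y => s + g1 (exp s * cos y) (exp s * sin y) in
  let G2 := fun s y => y + g2 (exp s * cos y) (exp s * sin y) in
  let DL := G1 (s0 + d1) (y0 + d2) - G1 s0 y0 in
  let DT := G2 (s0 + d1) (y0 + d2) - G2 s0 y0 in
  let X1 := cos lambda * DL + sin lambda * DT in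
  let X2 := cos lambda * DT - sin lambda * DL in
  Rabs (d1 * X2 - d2 * X1) <= tan beta * (d1 * X1 + d2 * X2).
Proof.
  intros Hb [Hf _] Hsp Hg s0 y0 d1 d2 Hs0 Hs1 G1 G2 DL DT X1 X2.
  set (zx := fun t => exp (s0 + t * d1) * cos (y0 + t * d2)).
  set (zy := fun t => exp (s0 + t * d1) * sin (y0 + t * d2)).
  assert (Hs : forall t, 0 <= t <= 1 -> s0 + t * d1 < 0)
    by (intros t Ht; destruct (Rle_dec d1 0); nra).
  assert (Hz : forall t, 0 <= t <= 1 -> in_disc (zx t, zy t) /\ (zx t, zy t) <> C0).
  { intros t Ht. specialize (Hs t Ht). unfold zx, zy.
    pose proof (exp_pos (s0 + t * d1)). apply exp_increasing in Hs. rewrite exp_0 in Hs.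
    pose proof (sin2_cos2 (y0 + t * d2)) as H2. unfold Rsqr in H2.
    set (e := exp (s0 + t * d1)) in *. set (c := cos (y0 + t * d2)) in *.
    set (s := sin (y0 + t * d2)) in *.
    assert (En : (e * c) ^ 2 + (e * s) ^ 2 = e * e).
    { transitivity (e * e * (s * s + c * c)); [ring | rewrite H2; ring]. }
    split.
    - apply in_disc_iff. rewrite En. nra.
    - intros E. injection E as E1 E2. rewrite E1, E2 in En. nra. }
  assert (HD : forall t, 0 <= t <= 1 -> _)
    by exact (fun t Ht => derivable_log_segment f (f' (zx t, zy t)) g1 g2 s0 y0 d1 d2 t (Hs t Ht) Hg
      (Hf _ (proj1 (Hz t Ht))) (proj1 (Hsp _ (proj1 (Hz t Ht)) (proj2 (Hz t Ht))))).
  pose proof (sector_increment _ _ _ d1 d2 lambda (tan beta)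
    (fun t Ht => proj1 (HD t Ht)) (fun t Ht => proj2 (HD t Ht))
    (fun t Ht => sector_tan _ lambda beta Hb
       (proj2 (Hsp _ (proj1 (Hz t Ht)) (proj2 (Hz t Ht)))))) as H.
  cbv beta zeta in H. rewrite !Rmult_0_l, !Rmult_1_l, !Rplus_0_r in H.
  exact H.
Qed.

(** * Boundedness of the logarithm and of f *)

Theorem theorem2 (f f' : Cplx -> Cplx) :
  in_A1 f f' ->
  (exists lambda alpha : R,
      - (PI / 2) < lambda < PI / 2 /\ 0 < alpha < 1 /\
      strongly_spirallike f f' lambda alpha) ->
  (exists g : Cplx -> Cplx,
      ccontinuous_on_disc g /\ g C0 = C0 /\
      (forall z : Cplx, in_disc z -> z <> C0 -> Cexp (g z) = Cdiv (f z) z) /\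
      (exists M : R, forall z : Cplx, in_disc z -> Cnorm (g z) <= M)) /\
  (exists M : R, forall z : Cplx, in_disc z -> Cnorm (f z) <= M).
Proof.
  intros HA [lambda [alpha [_ [Hal Hsp]]]]. pose proof PI_RGT_0 as Hpi.
  assert (Hb : 0 < PI * alpha / 2 < PI / 2) by nra.
  destruct (A1_log_quotient f f' HA) as [g1 [g2 [Hg1 [Hg2 Hg]]]].
  { intros z Hz Hz0. now apply Hsp. }
  pose proof (spirallike_log_increment f f' lambda _ g1 g2 Hb HA Hsp Hg) as Hsec.
  cbv beta zeta in Hsec.
  set (T := tan (PI * alpha / 2)) in *.
  assert (HT : 0 < T) by (apply tan_gt_0; lra).
  set (g := fun z : Cplx => (g1 (fst z) (snd z), g2 (fst z) (snd z))).
  assert (Hgc : ccontinuous_on_disc g).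
  { intros [x y] Hz eps He. apply in_disc_iff in Hz. destruct (Hg x y Hz) as [C1' [C2' _]].
    destruct (continuity_2d_pt_Cnorm g (x, y) C1' C2' eps He) as [d [Hd H]].
    exists d. split; auto. }
  assert (Hg0 : g C0 = C0) by (unfold g, C0; cbn [fst snd]; now rewrite Hg1, Hg2).
  assert (Hge : forall z : Cplx, in_disc z -> z <> C0 -> Cexp (g z) = Cdiv (f z) z).
  { intros [x y] Hz Hz0. apply in_disc_iff in Hz. now apply Hg. }
  assert (Hgb : exists M : R, forall z : Cplx, in_disc z -> Cnorm (g z) <= M).
  { assert (D0 : in_disc C0) by (apply in_disc_iff; lra).
    destruct (Hgc C0 D0 1 Rlt_0_1) as [d0 [Hd0 Hnear]].
    (* On the closed disc of radius [r] continuity at the origin gives |g| < 1. Its boundary circle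
       is the image of the reference line Re w = ln r, and ln r < 0 since r <= 1/2. *)
    set (r := Rmin (d0 / 2) (1 / 2)).
    assert (Hr : 0 < r) by (apply Rmin_glb_lt; lra).
    assert (Hr1 : r <= d0 / 2) by apply Rmin_l. assert (Hr2 : r <= 1 / 2) by apply Rmin_r.
    assert (Hsub0 : forall z, Csub z C0 = z).
    { intros [x y]. unfold Csub, Cadd, Copp, C0; cbn [fst snd]. f_equal; ring. }
    assert (Hsmall : forall z, Cnorm z <= r -> Cnorm (g z) < 1).
    { intros z Hz. rewrite <- (Hsub0 (g z)), <- Hg0. apply Hnear.
      - unfold in_disc. lra.
      - rewrite Hsub0. lra. }
    set (s0 := ln r).
    assert (Hs0 : s0 < 0) by (unfold s0; rewrite <- ln_1; apply ln_increasing; lra).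
    assert (Hpt : forall y, Rabs (g1 (exp s0 * cos y) (exp s0 * sin y)) < 1 /\
                            Rabs (g2 (exp s0 * cos y) (exp s0 * sin y)) < 1).
    { intros y. unfold s0. rewrite exp_ln by exact Hr.
      assert (Hn : Cnorm (g (r * cos y, r * sin y)) < 1).
      { apply Hsmall. unfold Cnorm; cbn [fst snd]. pose proof (sin2_cos2 y) as H2.
        unfold Rsqr in H2.
        replace ((r * cos y) ^ 2 + (r * sin y) ^ 2) with (r ^ 2).
        - rewrite sqrt_pow2; lra.
        - transitivity (r * r * (sin y * sin y + cos y * cos y)); [rewrite H2|]; ring. }
      split; (eapply Rle_lt_trans; [|exact Hn]).
      - exact (fst_le_Cnorm (g (r * cos y, r * sin y))).
      - exact (snd_le_Cnorm (g (r * cos y, r * sin y))). }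
    (* [S] bounds the horizontal distance from the line to any point with Re w < 0. [K] bounds a
       component of exp(-i lambda)(F c - F a): the points [a], [c] differ by 2 L i, and each
       component of g differs by at most 2 between them. *)
    set (S := - s0). set (L := S * T + 1). set (K := 2 * L + 4).
    set (M1 := (S + L * T) * K). set (M2 := (L + S * T) * K).
    assert (HS : 0 < S) by (unfold S; lra).
    assert (HL : 1 < L) by (unfold L; nra).
    assert (HM1 : 0 <= M1) by (unfold M1, K; apply Rmult_le_pos; nra).
    assert (HM2 : 0 <= M2) by (unfold M2, K; apply Rmult_le_pos; nra).
    exists (2 * (M1 + M2) + S + L + 2). intros [x y] Hz.
    destruct (Rle_dec (Cnorm (x, y)) r) as [Hle|Hgt].
    { apply Hsmall in Hle. lra. }
    apply Rnot_le_lt in Hgt. unfold in_disc in Hz.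
    destruct (polar_Arg x y) as [_ [Ex Ey]].
    change (sqrt (x ^ 2 + y ^ 2)) with (Cnorm (x, y)) in Ex, Ey.
    set (q := Cnorm (x, y)) in *. set (A := Arg (x, y)) in *.
    (* The point b is ln q + i A, a logarithm of z to the right of the reference line. *)
    assert (Hq : q = exp (ln q)) by (rewrite exp_ln; lra).
    assert (Hl1 : s0 < ln q) by (apply ln_increasing; lra).
    assert (Hl2 : ln q < 0) by (rewrite <- ln_1; apply ln_increasing; lra).
    set (d := ln q - s0).
    pose proof (Hsec s0 (A - L) d L Hs0 ltac:(unfold d; lra)) as HX.
    pose proof (Hsec s0 (A + L) d (- L) Hs0 ltac:(unfold d; lra)) as HY.
    replace (s0 + d) with (ln q) in HX, HY by (unfold d; ring).
    replace (A - L + L) with A in HX by ring.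
    replace (A + L + - L) with A in HY by ring.
    rewrite <- Hq, <- Ex, <- Ey in HX, HY.
    destruct (Hpt (A - L)) as [Ba1 Ba2]. destruct (Hpt (A + L)) as [Bc1 Bc2].
    apply Rabs_def2 in Ba1, Ba2, Bc1, Bc2.
    set (a1 := g1 (exp s0 * cos (A - L)) (exp s0 * sin (A - L))) in *.
    set (a2 := g2 (exp s0 * cos (A - L)) (exp s0 * sin (A - L))) in *.
    set (c1 := g1 (exp s0 * cos (A + L)) (exp s0 * sin (A + L))) in *.
    set (c2 := g2 (exp s0 * cos (A + L)) (exp s0 * sin (A + L))) in *.
    set (DL := ln q + g1 x y - (s0 + a1)) in *.
    set (DT := A + g2 x y - (A - L + a2)) in *.
    pose proof (COS_bound lambda) as Bc. pose proof (SIN_bound lambda) as Bs.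
    pose proof (sin2_cos2 lambda) as H2. unfold Rsqr in H2.
    set (c := cos lambda) in *. set (s := sin lambda) in *.
    destruct (two_sectors_bounded T S d L K _ _ _ _ HT ltac:(unfold d, S; lra) eq_refl HX HY)
      as [B1 B2].
    (* The unknown value at b cancels in the difference, which makes the bound uniform. *)
    { unfold DT, DL, K. nra. }
    fold M1 in B1. fold M2 in B2.
    set (X1 := c * DL + s * DT) in *. set (X2 := c * DT - s * DL) in *.
    (* Rotating back by [lambda] recovers the increments of F from the bounded [X1] and [X2]. *)
    assert (EL : DL = c * X1 - s * X2).
    { unfold X1, X2. transitivity ((s * s + c * c) * DL); [rewrite H2|]; ring. }
    assert (ET : DT = s * X1 + c * X2).
    { unfold X1, X2. transitivity ((s * s + c * c) * DT); [rewrite H2|]; ring. }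
    assert (Hmul : forall a b m, -1 <= a <= 1 -> Rabs b <= m -> - m <= a * b <= m).
    { intros a b m Ha Hbm. apply Rabs_le_between. rewrite Rabs_mult.
      assert (Rabs a <= 1) by (apply Rabs_le; lra). pose proof (Rabs_pos a).
      pose proof (Rabs_pos b). nra. }
    pose proof (Hmul _ _ _ Bc B1). pose proof (Hmul _ _ _ Bc B2).
    pose proof (Hmul _ _ _ Bs B1). pose proof (Hmul _ _ _ Bs B2).
    eapply Rle_trans; [apply Cnorm_le_sum|]. unfold g; cbn [fst snd].
    assert (Rabs (g1 x y) <= M1 + M2 + S + 1).
    { apply Rabs_le. unfold DL in EL. unfold S in *. lra. }
    assert (Rabs (g2 x y) <= M1 + M2 + L + 1).
    { apply Rabs_le. unfold DT in ET. lra. }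
    lra. }
  split; [exists g; auto|].
  (* Away from the origin |f(z)| = |z| exp(Re g(z)), with |z| < 1 and Re g(z) <= M. *)
  destruct Hgb as [M HM]. exists (exp M). intros z Hz.
  destruct (excluded_middle_informative (z = C0)) as [->|Hz0].
  - rewrite (proj1 (proj2 HA)). unfold Cnorm, C0; cbn [fst snd].
    match goal with |- sqrt ?e <= _ => replace e with 0 by ring end.
    rewrite sqrt_0. left; apply exp_pos.
  - specialize (HM z Hz). specialize (Hge z Hz Hz0).
    assert (Ef : f z = Cmul (Cexp (g z)) z).
    { rewrite Hge. destruct z as [x y]. apply C_neq_0 in Hz0. destruct (f (x, y)).
      unfold Cdiv, Cmul, Cinv; cbn [fst snd]. f_equal; field; lra. }
    assert (En : Cnorm (Cexp (g z)) = exp (fst (g z))).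
    { unfold Cnorm, Cexp; cbn [fst snd]. pose proof (sin2_cos2 (snd (g z))) as H2.
      unfold Rsqr in H2. pose proof (exp_pos (fst (g z))).
      rewrite <- (sqrt_pow2 (exp (fst (g z)))) at 3 by lra. f_equal.
      match goal with |- _ = ?e => transitivity (e * 1); [rewrite <- H2|]; ring end. }
    rewrite Ef, Cnorm_mul, En. unfold in_disc in Hz.
    pose proof (exp_pos (fst (g z))). assert (0 <= Cnorm z) by apply sqrt_pos.
    assert (exp (fst (g z)) <= exp M).
    { pose proof (fst_le_Cnorm (g z)) as H1. pose proof (Rle_abs (fst (g z))).
      destruct (Rle_lt_or_eq_dec (fst (g z)) M ltac:(lra)) as [Hlt| ->]; [|lra].
      left; now apply exp_increasing. }
    nra.
Qed.
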